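(* Let $\nu>0$, let $\Theta=\{\mathbf{x}_1,\dots,\mathbf{x}_{n+1}\}\subset\mathbb{R}^n$ be a fixed set of $n+1$ affinely independent vectors, and let $\mathbf{x}_0$ be an arbitrary point of $\mathrm{conv}(\Theta)$. Define $$\mathbf{w}=\frac{\sum_{i=0}^{n+1}|\ell_i(\mathbf{x}_0)|\,\mathbf{x}_i}{\sum_{i=0}^{n+1}|\ell_i(\mathbf{x}_0)|},\qquad \bar z(\Theta,\mathbf{x}_0)=\frac{\nu}{2}\sum_{i=0}^{n+1}|\ell_i(\mathbf{x}_0)|\,\|\mathbf{x}_i-\mathbf{w}\|^2 .$$ Then $\mathbf{w}=\mathbf{x}_0$ and $\bar z(\Theta,\mathbf{x}_0)=\frac{\nu}{2}\sum_{i=0}^{n+1}\ell_i(\mathbf{x}_0)\|\mathbf{x}_i\|^2$.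
   Context: $\|\cdot\|$ is the Euclidean norm and $\mathrm{conv}(\Theta)$ is the convex hull of $\Theta$. For $i=1,\dots,n+1$, $\ell_i$ is the Lagrange polynomial of $\Theta$, i.e. the unique affine function $\mathbb{R}^n\to\mathbb{R}$ with $\ell_i(\mathbf{x}_j)=1$ if $j=i$ and $\ell_i(\mathbf{x}_j)=0$ if $j\ne i$ ($j=1,\dots,n+1$); additionally $\ell_0$ is the constant function $\ell_0\equiv-1$. *)

(* Defs.v *)
From HB Require Import structures.
From mathcomp Require Import all_boot all_order all_algebra.
From mathcomp Require Import boolp classical_sets functions reals convex.

Set Implicit Arguments.
Unset Strict Implicit.
Unset Printing Implicit Defensive.

Import Order.TTheory GRing.Theory Num.Theory.
Local Open Scope classical_set_scope.
Local Open Scope ring_scope.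

(* The canonical norm of ['rV[R]_n] in MathComp-Analysis is the sup norm, so
   the Euclidean norm is defined here. *)
Definition enorm (R : realType) (n : nat) (u : 'rV[R]_n) : R :=
  Num.sqrt (\sum_(k < n) u 0 k ^+ 2).

Definition conv_hull (R : realType) (M : lmodType R) (A : set M) : set M :=
  smallest (@convex_set R M) A.

Definition affinely_independent (R : realType) (M : lmodType R) (m : nat)
    (x : 'I_m -> M) : Prop :=
  forall c : 'I_m -> R,
    \sum_(i < m) c i = 0 -> \sum_(i < m) c i *: x i = 0 -> forall i, c i = 0.

Definition affine_function (R : realType) (M : lmodType R) (f : M -> R) : Prop :=
  exists (g : {scalar M}) (b : R), forall u, f u = g u + b.

Section Interpolation.
Context {R : realType} {n : nat}.
Variable Theta : 'I_n.+1 -> 'rV[R]_n.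

Definition is_lagrange (i : 'I_n.+1) (f : 'rV[R]_n -> R) : Prop :=
  affine_function f /\ forall j, f (Theta j) = (j == i)%:R.

(* [xget] selects an element of the set; by [lagrangeP] below this set is a
   singleton when [Theta] is affinely independent, so that the default value
   [cst 0] is irrelevant. *)
Definition lagrange (i : 'I_n.+1) : 'rV[R]_n -> R :=
  xget (cst 0) [set f | is_lagrange i f].

(* The families x_0, x_1, .., x_(n+1) and l_0, l_1, .., l_(n+1): index [ord0]
   is the added element and index [lift ord0 i] is the [i]-th element of the
   0-based family indexed by ['I_n.+1]. *)
Definition pt (x0 : 'rV[R]_n) (i : 'I_n.+2) : 'rV[R]_n :=
  if unlift ord0 i is Some j then Theta j else x0.

Definition ell (i : 'I_n.+2) : 'rV[R]_n -> R :=
  if unlift ord0 i is Some j then lagrange j else cst (- 1).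

Definition wcenter (x0 : 'rV[R]_n) : 'rV[R]_n :=
  (\sum_(i < n.+2) `|ell i x0|)^-1 *: \sum_(i < n.+2) `|ell i x0| *: pt x0 i.

Definition zbar (nu : R) (x0 : 'rV[R]_n) : R :=
  nu / 2 *
  \sum_(i < n.+2) `|ell i x0| * enorm (pt x0 i - wcenter x0) ^+ 2.

Let V : 'M[R]_(1 + n) := \matrix_i row_mx (const_mx 1 : 'rV_1) (Theta i).

Let mulV (c : 'rV[R]_n.+1) :
  c *m V = row_mx (const_mx (\sum_i c 0 i) : 'rV_1) (\sum_i c 0 i *: Theta i).
Proof.
apply/rowP => k; rewrite mxE -[k](splitK (m := 1)).
case: (fintype.split k) => j /=.
  rewrite row_mxEl mxE; apply: eq_bigr => i _.
  by rewrite mxE row_mxEl mxE mulr1.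
rewrite row_mxEr summxE; apply: eq_bigr => i _.
by rewrite mxE row_mxEr !mxE.
Qed.

Hypothesis Theta_free : affinely_independent Theta.

Let V_unit : V \in unitmx.
Proof.
rewrite -row_free_unit; apply/row_freeP.
suff : row_free V by move/row_freeP.
rewrite -kermx_eq0; apply/eqP/row_matrixP => i; rewrite row0.
have : row i (kermx V) *m V = 0 by rewrite -row_mul mulmx_ker row0.
set c := row i _; rewrite mulV -[0 in RHS]row_mx0 => /eq_row_mx[c0 cT].
apply/rowP => k; rewrite [RHS]mxE; apply: (Theta_free (c := c 0)) => //.
by move/matrixP: c0 => /(_ 0 0); rewrite !mxE.
Qed.

Let coords (u : 'rV[R]_n) : 'rV[R]_n.+1 :=
  row_mx (const_mx 1 : 'rV_1) u *m invmx V.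

Let coordsP u : \sum_i coords u 0 i = 1 /\ \sum_i coords u 0 i *: Theta i = u.
Proof.
have : coords u *m V = row_mx (const_mx 1 : 'rV_1) u by rewrite mulmxKV.
rewrite mulV => /eq_row_mx[/matrixP/(_ 0 0)].
by rewrite !mxE.
Qed.

Lemma affine_function_eq (f g : 'rV[R]_n -> R) :
  affine_function f -> affine_function g ->
  (forall j, f (Theta j) = g (Theta j)) -> f = g.
Proof.
have aux h : affine_function h ->
    forall u, h u = \sum_i coords u 0 i * h (Theta i).
  move=> [l [b hE]] u; have [s1 su] := coordsP u.
  rewrite hE -[in LHS]su linear_sum -[b in LHS]mul1r -[in LHS]s1 mulr_suml.
  rewrite -big_split /=; apply: eq_bigr => i _.
  by rewrite linearZ hE mulrDr.
move=> /aux fE /aux gE fg; apply/funext => u; rewrite fE gE.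
by apply: eq_bigr => i _; rewrite fg.
Qed.

Lemma is_lagrange_exists i : exists f, is_lagrange i f.
Proof.
pose l u := (row_mx (0 : 'rV_1) u *m invmx V) 0 i.
have l_lin : scalar l.
  move=> a u v; rewrite /l.
  have -> : row_mx (0 : 'rV_1) (a *: u + v) = a *: row_mx 0 u + row_mx 0 v
    by rewrite scale_row_mx add_row_mx scaler0 addr0.
  by rewrite mulmxDl -scalemxAl mxE; congr (_ + _); rewrite mxE.
pose lL := GRing.isLinear.Build R 'rV[R]_n R *%R l l_lin.
pose L : {scalar 'rV[R]_n} := HB.pack l lL.
exists (fun u => coords u 0 i); split.
  exists L, ((row_mx (const_mx 1 : 'rV_1) (0 : 'rV_n) *m invmx V) 0 i) => u.
  rewrite /= /l /coords -[const_mx 1]add0r -{1}[u]addr0 -add_row_mx mulmxDl.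
  by rewrite mxE add0r.
move=> j; rewrite /coords.
have -> : row_mx (const_mx 1 : 'rV_1) (Theta j) = row j V
  by rewrite rowK.
by rewrite -row_mul mulmxV // !mxE.
Qed.

Lemma lagrangeP i f : is_lagrange i f <-> f = lagrange i.
Proof.
have Hl : is_lagrange i (lagrange i).
  have [g Hg] := is_lagrange_exists i; rewrite /lagrange.
  by apply: (xgetPex (cst 0) (P := [set f | is_lagrange i f])); exists g.
split=> [Hf|-> //]; apply: affine_function_eq; [exact: Hf.1|exact: Hl.1|].
by move=> j; rewrite Hf.2 Hl.2.
Qed.

End Interpolation.

(* Main.v *)
Require Import Defs.
From mathcomp Require Import all_boot all_order all_algebra.
From mathcomp Require Import boolp classical_sets functions reals convex.
From mathcomp Require Import interval_inference ring.

Import Order.TTheory GRing.Theory Num.Theory.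
Local Open Scope classical_set_scope.
Local Open Scope ring_scope.

(** The values [l_i(x0)] of the Lagrange polynomials are the barycentric
    coordinates of [x0] in the simplex spanned by [Theta]. Indeed a point of the
    convex hull is a convex combination [x0 = \sum_i c i *: Theta i]
    ([conv_hull_combination]), and since an affine function commutes with
    combinations of total weight 1 ([affine_function_combination]), evaluating
    the [i]-th polynomial at [x0] returns [c i] ([lagrange_combination]).

    Hence on the convex hull the absolute values matter only for [l_0 = -1]:
    the weights defining the center are 1 on [x0] and [c i] on [Theta i]. They
    add up to 2 and the weighted sum of points is [x0 + x0], so the center is
    [x0]. The term of index 0 of [zbar] then vanishes, and the parallel axis
    identity ([sum_enorm_centered]) turns the remaining variance into
    [\sum_i c i * |Theta i|^2 - |x0|^2], where the subtracted square is exactly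
    the contribution of [l_0] to the right-hand side. *)

Lemma affine_function_combination {R : realType} {M : lmodType R} (f : M -> R)
    {m : nat} (c : 'I_m -> R) (x : 'I_m -> M) :
  affine_function f -> \sum_(i < m) c i = 1 ->
  f (\sum_(i < m) c i *: x i) = \sum_(i < m) c i * f (x i).
Proof.
move=> [g [b fE]] c1; rewrite fE linear_sum -[b in LHS]mul1r -c1 mulr_suml.
by rewrite -big_split; apply: eq_bigr => i _ /=; rewrite linearZ fE mulrDr.
Qed.

(** The hull is defined as a smallest convex set, so it suffices that the convex
    combinations of the family form a convex set containing the family. *)
Lemma conv_hull_combination {R : realType} {M : lmodType R} {m : nat}
    (x : 'I_m -> M) (u : M) :
  conv_hull (range x) u ->
  exists c : 'I_m -> R, [/\ forall i, 0 <= c i, \sum_(i < m) c i = 1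
    & \sum_(i < m) c i *: x i = u].
Proof.
move: u; apply: smallest_sub => [u v t|_ [j _ <-]].
  rewrite !inE => -[c [c0 c1 <-]] [d [d0 d1 <-]].
  exists (fun i => t%:num * c i + (1 - t%:num) * d i); split.
  - by move=> i; rewrite addr_ge0 // mulr_ge0.
  - by rewrite big_split -!mulr_sumr /= c1 d1 !mulr1 subrKC.
  - rewrite [RHS]/conv /= !scaler_sumr -big_split; apply: eq_bigr => i _ /=.
    by rewrite scalerDl !scalerA.
exists (fun i => (i == j)%:R); split => [i||]; first exact: ler0n.
  by rewrite (bigD1 j) //= eqxx big1 ?addr0 // => i /negPf ->.
rewrite (bigD1 j) //= eqxx scale1r big1 ?addr0 // => i /negPf ->.
by rewrite scale0r.
Qed.

Lemma lagrange_combination {R : realType} {n : nat}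
    (Theta : 'I_n.+1 -> 'rV[R]_n) (c : 'I_n.+1 -> R) (i : 'I_n.+1) :
  affinely_independent Theta -> \sum_j c j = 1 ->
  Defs.lagrange Theta i (\sum_j c j *: Theta j) = c i.
Proof.
move=> Tfree c1.
have [aff lT] : is_lagrange Theta i (Defs.lagrange Theta i) by apply/lagrangeP.
rewrite affine_function_combination // (bigD1 i) //= lT eqxx mulr1.
by rewrite big1 ?addr0 // => j /negPf ji; rewrite lT ji mulr0.
Qed.

Lemma enorm_sqr {R : realType} {n : nat} (u : 'rV[R]_n) :
  enorm u ^+ 2 = \sum_(k < n) u 0 k ^+ 2.
Proof. by rewrite sqr_sqrtr // sumr_ge0 // => k _; apply: sqr_ge0. Qed.

(** Parallel axis (Koenig-Huygens) identity. It holds coordinatewise, because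
    the cross term [2 w_k \sum_i c i (x i)_k] equals [2 w_k ^ 2]. *)
Lemma sum_enorm_centered {R : realType} {n m : nat} (c : 'I_m -> R)
    (x : 'I_m -> 'rV[R]_n) (w : 'rV[R]_n) :
  \sum_(i < m) c i = 1 -> \sum_(i < m) c i *: x i = w ->
  \sum_(i < m) c i * enorm (x i - w) ^+ 2 =
  \sum_(i < m) c i * enorm (x i) ^+ 2 - enorm w ^+ 2.
Proof.
move=> c1 xw.
have sqrE (y : 'I_m -> 'rV[R]_n) : \sum_(i < m) c i * enorm (y i) ^+ 2 =
    \sum_(k < n) \sum_(i < m) c i * y i 0 k ^+ 2.
  rewrite exchange_big; apply: eq_bigr => i _ /=.
  by rewrite enorm_sqr mulr_sumr.
rewrite !sqrE enorm_sqr -sumrB; apply: eq_bigr => k _.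
have wk : \sum_(i < m) c i * x i 0 k = w 0 k.
  by rewrite -xw summxE; apply: eq_bigr => i _; rewrite mxE.
transitivity (\sum_(i < m) (c i * x i 0 k ^+ 2
    - 2 * w 0 k * (c i * x i 0 k) + w 0 k ^+ 2 * c i)).
  by apply: eq_bigr => i _; rewrite !mxE; ring.
by rewrite big_split sumrB -!mulr_sumr /= wk c1; ring.
Qed.

Theorem theorem4p3 (R : realType) (n : nat) (nu : R)
    (Theta : 'I_n.+1 -> 'rV[R]_n) (x0 : 'rV[R]_n) :
  0 < nu ->
  affinely_independent Theta ->
  conv_hull (range Theta) x0 ->
  wcenter Theta x0 = x0 /\
  zbar Theta nu x0 =
    nu / 2 * \sum_(i < n.+2) ell Theta i x0 * enorm (pt Theta x0 i) ^+ 2.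
Proof.
move=> _ Tfree /conv_hull_combination[c [c0 c1 x0E]].
have ell0 : ell Theta ord0 x0 = - 1 by rewrite /ell unlift_none.
have ellS i : ell Theta (lift ord0 i) x0 = c i.
  by rewrite /ell liftK -x0E lagrange_combination.
have pt0 : pt Theta x0 ord0 = x0 by rewrite /pt unlift_none.
have ptS i : pt Theta x0 (lift ord0 i) = Theta i by rewrite /pt liftK.
have absE (V : lmodType R) (F : 'I_n.+2 -> V) :
    \sum_(i < n.+2) `|ell Theta i x0| *: F i =
    F ord0 + \sum_(i < n.+1) c i *: F (lift ord0 i).
  rewrite big_ord_recl ell0 normrN1 scale1r; congr (_ + _).
  by apply: eq_bigr => i _; rewrite ellS ger0_norm.
have mass : \sum_(i < n.+2) `|ell Theta i x0| = 2.
  have := absE R^o (fun=> 1); rewrite -!scaler_suml c1.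
  by rewrite /GRing.scale /= !mulr1 => ->.
have wE : wcenter Theta x0 = x0.
  rewrite /wcenter mass absE pt0; under eq_bigr do rewrite ptS.
  by rewrite x0E -mulr2n -scaler_nat scalerA mulVf ?scale1r // pnatr_eq0.
split=> //; rewrite /zbar wE; congr (_ * _).
rewrite (absE R^o) pt0 subrr; under eq_bigr do rewrite ptS.
rewrite (sum_enorm_centered _ _ _ c1 x0E) enorm_sqr.
rewrite big1 => [|k _]; last by rewrite mxE expr0n.
rewrite [RHS]big_ord_recl ell0 pt0 mulN1r add0r addrC; congr (_ + _).
by apply: eq_bigr => i _; rewrite ellS ptS.
Qed.
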